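(* For $n\ge1$ let $a_n=|\mathfrak{S}_n^{\nearrow}(132)|$, i.e. the number of nom codes $f\in F_n^{\nearrow}$ such that $\phi(f)$ avoids $132$, and let $p_m$ denote the number of integer partitions of $m$. Then $a_1=1$ and $a_n=a_{n-1}+p_{n-1}$ for all $n\ge 2$.
   Context: $[n]=\{1,\dots,n\}$, $\mathfrak{S}_n$ the symmetric group on $[n]$; products of permutations are composed with the leftmost factor acting first: $(\alpha\beta)(x)=\beta(\alpha(x))$. A function $f:[n]\to[n]$ is subexceedant if $1\le f(i)\le i$ for all $i$, written $f_1\cdots f_n$; $F_n$ is the set of such functions. $\phi:F_n\to\mathfrak{S}_n$, $\phi(f)=(1,f_1)(2,f_2)\cdots(n,f_n)$ (with $(i,i)$ the identity), is a bijection; $\phi^{-1}(\sigma)$ is the nom code of $\sigma$. $F_n^{\nearrow}$ is the set of non-decreasing subexceedant functions on $[n]$, $\mathfrak{S}_n^{\nearrow}=\phi(F_n^{\nearrow})$. A permutation $\sigma$ contains a pattern $\pi\in\mathfrak{S}_3$ if there are $a<b<c$ with $\sigma(a)\sigma(b)\sigma(c)$ in the same relative order as $\pi(1)\pi(2)\pi(3)$, and avoids it otherwise; $\mathfrak{S}_n^{\nearrow}(\pi)$ is the set of $\sigma\in\mathfrak{S}_n^{\nearrow}$ avoiding $\pi$. *)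

(* Defs.v *)
From mathcomp Require Import all_boot all_fingroup.

Set Implicit Arguments.
Unset Strict Implicit.
Unset Printing Implicit Defensive.

(* The set [n] = {1, ..., n} is represented by 'I_n = {0, ..., n - 1}, so that
   positions and values are all shifted down by one; in particular the condition
   1 <= f(i) <= i becomes f i <= i. *)

Definition subexceedant n (f : {ffun 'I_n -> 'I_n}) : bool :=
  [forall i : 'I_n, f i <= i].

Definition nondecreasing n (f : {ffun 'I_n -> 'I_n}) : bool :=
  [forall i : 'I_n, forall j : 'I_n, (i <= j) ==> (f i <= f j)].

Definition F_incr n : {set {ffun 'I_n -> 'I_n}} :=
  [set f | subexceedant f & nondecreasing f].

(* The product is taken in increasing order of i, and in 'S_n the leftmost
   factor acts first: (s * t) x = t (s x), see permM. *)
Definition phi n (f : {ffun 'I_n -> 'I_n}) : 'S_n :=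
  (\prod_(i < n) tperm i (f i))%g.

Definition S_incr n : {set 'S_n} := [set phi f | f in F_incr n].

(* g lists the three positions a < b < c of the occurrence. *)
Definition contains n (pi : 'S_3) (sigma : 'S_n) : bool :=
  [exists g : {ffun 'I_3 -> 'I_n},
     [forall i : 'I_3, forall j : 'I_3, (i < j) ==> (g i < g j)] &&
     [forall i : 'I_3, forall j : 'I_3, (sigma (g i) < sigma (g j)) == (pi i < pi j)]].

Definition S_incr_avoiding n (pi : 'S_3) : {set 'S_n} :=
  [set sigma in S_incr n | ~~ contains pi sigma].

(* One-line notation 132: the first point is fixed, the last two are swapped. *)
Definition pattern132 : 'S_3 := tperm (inord 1) (inord 2).

Definition a n : nat := #|S_incr_avoiding n pattern132|.

Definition is_partition (m : nat) (s : seq nat) : bool :=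
  [&& sorted geq s, 0 \notin s & sumn s == m].

(* A partition of m has at most m parts, all of them at most m, so all the
   partitions of m occur among the sequences of length at most m over 'I_m.+1;
   see is_partition_bseq. *)
Definition npartitions (m : nat) : nat :=
  #|[set s : {bseq m of 'I_m.+1} | is_partition m (map val s)]|.

Lemma is_partition_bseq m (s : seq nat) :
  is_partition m s -> exists t : {bseq m of 'I_m.+1}, map val t = s.
Proof.
case/and3P=> _ s0 /eqP sm.
have szs : size s <= m.
  rewrite -sm; elim: s s0 {sm} => //= x s IHs.
  rewrite inE negb_or eq_sym -lt0n => /andP[x0 /IHs xs].
  by rewrite -add1n leq_add.
have les x : x \in s -> x < m.+1.
  rewrite ltnS -sm; elim: s {s0 sm szs} => //= y s IHs.
  rewrite inE => /orP[/eqP->|/IHs xs]; first exact: leq_addr.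
  exact: leq_trans xs (leq_addl _ _).
have szt : size (map (@inord m) s) <= m by rewrite size_map.
exists (Bseq szt); rewrite /= -map_comp -[RHS]map_id.
by apply/eq_in_map => x /les ltx; apply: inordK.
Qed.

(* Main.v *)
(* Work with positions and values in {0, ..., n - 1}.  Codes with f (n - 1) = n - 1
   are the codes of size n - 1 with a final fixed point, and appending a fixed
   maximum creates no 132; this accounts for a (n - 1).  For the other codes,
   avoiding 132 forces the following shape: 1, ..., n - 1 are the cells of the Young
   diagram of a partition of n - 1, numbered row after row, and f c is the cell
   just above c, or 0 when c is in the first row.  If the first row has w cells, the
   permutation maps j < w to the bottom cell of column j, w to 0, and c > w to f c;
   f is increasing there.  The bottoms form, from left to right, blocks of
   consecutive values (one block for each row containing bottoms), each block
   lying below the preceding ones, hence there is no 132. *)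

Require Import Defs.
From mathcomp Require Import all_boot all_fingroup.
From mathcomp Require Import zify.

Set Implicit Arguments.
Unset Strict Implicit.
Unset Printing Implicit Defensive.

(** * Products of transpositions acting on natural numbers *)

Definition transpose (i j x : nat) : nat :=
  if x == i then j else if x == j then i else x.

(** The product of transpositions followed at a single point. Working over [nat] lets every prefix
    of a code be evaluated without changing types. *)
Fixpoint eval (f : nat -> nat) (x n : nat) : nat :=
  if n is k.+1 then transpose k (f k) (eval f x k) else x.

Definition subexc (f : nat -> nat) n := forall i, i < n -> f i <= i.

Definition nondecr (f : nat -> nat) n :=
  forall i j, i <= j -> j < n -> f i <= f j.

Definition has132 (s : nat -> nat) n :=
  exists i j k, [/\ i < j, j < k, k < n & s i < s k < s j].

Lemma transpose_inj i j : injective (transpose i j).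
Proof. by move=> x y; rewrite /transpose; do !case: eqP; lia. Qed.

Lemma eval_inj f n : injective (eval f ^~ n).
Proof. by elim: n => [|n IH] x y //= /transpose_inj /IH. Qed.

Lemma eq_eval f g n x : (forall i, i < n -> f i = g i) -> eval f x n = eval g x n.
Proof.
elim: n => //= n IH e; rewrite IH ?e // => i lin; exact/e/leqW.
Qed.

Section Eval.

Variables (f : nat -> nat) (n : nat).
Hypothesis fsub : subexc f n.

Lemma eval_ge x m : m <= n -> m <= x -> eval f x m = x.
Proof.
elim: m => //= m IH ltmn ltmx; rewrite IH; try lia.
by have := fsub ltmn; rewrite /transpose; do !case: eqP; lia.
Qed.

Lemma eval_self x : x < n -> eval f x x.+1 = f x.
Proof. by move=> ltxn; rewrite /= eval_ge ?(ltnW ltxn) // /transpose eqxx. Qed.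

Lemma eval_lt x m : x < m -> m <= n -> eval f x m < m.
Proof.
elim: m => //= m IH ltxm ltmn; have := fsub ltmn.
have [ltx|lemx] := ltnP x m.
  by have := IH ltx (ltnW ltmn); rewrite /transpose; do !case: eqP; lia.
have -> : x = m by lia.
by rewrite eval_ge ?(ltnW ltmn) // /transpose eqxx; lia.
Qed.

(** The current value of [x] is below [m], so the transposition of [m] and [f m] either misses it or
    raises it to [m]. *)
Lemma evalS x m : x < m -> m < n ->
  eval f x m.+1 = if eval f x m == f m then m else eval f x m.
Proof.
by move=> ltxm ltmn; have := eval_lt ltxm (ltnW ltmn); rewrite /= /transpose; case: eqP; lia.
Qed.

Lemma eval_mono x m p : x < m -> m <= p -> p <= n -> eval f x m <= eval f x p.
Proof.
move=> ltxm; elim: p => [|p IH]; first by lia.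
rewrite leq_eqVlt => /predU1P[-> //|lemp] ltpn.
apply: leq_trans (IH lemp (ltnW ltpn)) _.
have ltxp : x < p by lia.
rewrite (evalS ltxp ltpn); case: ifP => // _.
exact/ltnW/eval_lt/ltnW.
Qed.

Lemma eval_stable x m p : x < m -> m <= p -> p <= n ->
  (forall i, m <= i < p -> f i <> eval f x m) -> eval f x p = eval f x m.
Proof.
move=> ltxm; elim: p => [|p IH]; first by lia.
rewrite leq_eqVlt => /predU1P[<- //|lemp] ltpn nf.
have e : eval f x p = eval f x m.
  by apply: IH => [||i ?]; try apply: nf; lia.
rewrite evalS ?e //; last lia.
by case: eqP => // e'; case: (nf p); rewrite ?e' //; lia.
Qed.

(** The last position [j] of a value enters with that value, and all later values of [f] are larger,
    so no further transposition moves it. *)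
Lemma last_occurrence i : nondecr f n -> i < n ->
  exists j, [/\ i <= j, j < n, f j = f i & eval f j n = f i].
Proof.
move=> fmono; have [k] := ubnP (n - i); elim: k i => // k IH i ltk ltin.
have [/andP[lt1 /eqP e]|next] := boolP ((i.+1 < n) && (f i.+1 == f i)).
  have [||j] := IH i.+1; try lia.
  by rewrite e => -[leij *]; exists j; split=> //; apply: ltnW.
exists i; split => //; rewrite -[RHS]eval_self //.
apply: eval_stable => // j /andP[leij ltjn]; rewrite eval_self // => e.
move: next; rewrite (leq_ltn_trans leij ltjn) /= => /eqP; apply.
by have := fmono i i.+1; have := fmono i.+1 j; lia.
Qed.

End Eval.

(** * Diagram codes and their permutations *)

(* The fuel [k] stands for well-founded recursion: [f] decreases on the cells
   considered. *)
Fixpoint column_top (f : nat -> nat) (k c : nat) : nat :=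
  if k is k'.+1 then if f c == 0 then c else column_top f k' (f c) else c.

(** The predecessor appears because the first row starts with cell 1. With this numbering the point
    [j] runs down column [j]. *)
Definition column f c := (column_top f c c).-1.

(* [1, ..., n - 1] are the cells of a Young diagram numbered row after row, and
   [f c] is the cell just above [c], with [f c = 0] in the first row.  Column
   [0] consists of the first cells of the rows, so the last disjunction says that
   [i.+1] either continues the row of [i] or starts a new one. *)
Definition diagram_code (f : nat -> nat) n :=
  [/\ f 0 = 0,
      forall i, 0 < i < n -> f i < i &
      forall i, i.+1 < n ->
        (f i = 0 /\ f i.+1 = 0) \/
        (f i < f i.+1 /\ (f i.+1 = (f i).+1 \/ column f (f i.+1) = 0))].

Lemma column0 f c : f c = 0 -> column f c = c.-1.
Proof. by case: c => // c e; rewrite /column /= e. Qed.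

Lemma column_topE f n k c : (forall i, 0 < i < n -> f i < i) ->
  0 < c < n -> c <= k -> column_top f k c = column_top f c c.
Proof.
move=> flt; elim/ltn_ind: c k => -[//|c] IH [//|k] cn ck /=.
case: eqP => // /eqP; rewrite -lt0n => fpos.
have ltf := flt _ cn.
by rewrite (IH (f c.+1)) 1?[RHS](IH (f c.+1)) //; lia.
Qed.

Section DiagramCode.

Variables (f : nat -> nat) (n : nat).
Hypothesis fcode : diagram_code f n.

Let flt i : 0 < i -> i < n -> f i < i.
Proof. by case: fcode => _ h _ *; apply: h; lia. Qed.

Lemma diagram_code_subexc : subexc f n.
Proof.
by move=> [|i] lin; [case: fcode => -> | exact/ltnW/flt].
Qed.
Let fsub := diagram_code_subexc.

Lemma diagram_code_nondecr : nondecr f n.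
Proof.
move=> i; elim=> [|j IH]; first by rewrite leqn0 => /eqP->.
rewrite leq_eqVlt => /predU1P[-> //|leij] ltjn.
apply: leq_trans (IH leij (ltnW ltjn)) _.
by case: fcode => _ _ /(_ j ltjn)[[-> ->]|[/ltnW]].
Qed.
Let fmono := diagram_code_nondecr.

Lemma diagram_code_strict i j : i < j -> j < n -> 0 < f j -> f i < f j.
Proof.
case: j => // j leij ltjn fpos; apply: leq_ltn_trans (@fmono i j leij (ltnW ltjn)) _.
by case: fcode => _ _ /(_ j ltjn)[[_ e]|[]]; first by rewrite e in fpos.
Qed.

Lemma column_above c : 0 < c -> c < n -> 0 < f c -> column f c = column f (f c).
Proof.
case: c => // c c0 ltcn fpos; rewrite /column /=; case: eqP; first by lia.
move=> _; congr _.-1; have := flt c0 ltcn => ltf.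
by rewrite (@column_topE f n) ?fpos /=; [|case: fcode | lia |lia].
Qed.

Lemma column_lt c : 0 < c -> c < n -> column f c < c.
Proof.
elim/ltn_ind: c => c IH c0 ltcn; have [e|fpos] := posnP (f c).
  by rewrite column0 //; lia.
rewrite column_above //; have := flt c0 ltcn => ltf.
by apply: ltn_trans (IH _ _ _ _) _; lia.
Qed.

(** Below the first row, a cell in a positive column continues its row, so the cells above [k] and
    [k.-1] are consecutive and induction applies to them. *)
Lemma column_pred k : 0 < k -> k < n -> 0 < column f k ->
  column f k = (column f k.-1).+1.
Proof.
elim/ltn_ind: k => -[//|k] IH _ ltkn cpos.
have ltk : k < n by lia.
have k0 : 0 < k.
  by case: k {IH} cpos ltkn ltk => // + ltkn _; have := @column_lt 1 isT ltkn; lia.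
have [_ _ /(_ k ltkn)[[e e']|[h]]] := fcode.
  by rewrite !column0 //= prednK.
have ltf := flt (ltn0Sn k) ltkn.
have fpos : 0 < f k.+1 by lia.
rewrite column_above // in cpos *; case=> [e|e]; last by rewrite e in cpos.
(* If [f k = 0], the cell above [k.+1] is 1, which lies in column 0. *)
have [ek|fk] := posnP (f k).
  by move: cpos; rewrite e ek; have := @column_lt 1 isT; lia.
by rewrite IH //; try lia; rewrite e /= -column_above.
Qed.

Lemma column_sub k t : 0 < k -> k < n -> t <= column f k ->
  [/\ t < k & column f (k - t) = column f k - t].
Proof.
move=> k0 ltkn; elim: t => [|t IH] let_; first by rewrite !subn0.
case: IH => [|lt e]; first by lia.
have ltkt : k - t < n by lia.
have := @column_lt (k - t); have := @column_pred (k - t).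
rewrite e subnS => e1 e2; split; first by lia.
by have := e1; lia.
Qed.

(** The point descends its column: it waits at [f c] until step [c], because positive values of [f]
    do not repeat, and is then sent to [c]. In the first row it enters with value 0 and the very
    next step sends it to [c]. *)
Lemma eval_column c : 0 < c -> c < n -> eval f (column f c) c.+1 = c.
Proof.
elim/ltn_ind: c => c IH c0 ltcn; have cl := column_lt c0 ltcn.
rewrite (evalS fsub) //; have [e|fpos] := posnP (f c).
  have e1 : c = (column f c).+1 by rewrite column0 //; lia.
  rewrite {2}e1 (eval_self fsub); last by lia.
  suff -> : f (column f c) = f c by rewrite eqxx.
  by have := @fmono (column f c) c; lia.
have ltf := flt c0 ltcn.
have ev := IH _ ltf fpos (ltn_trans ltf ltcn).
rewrite column_above //; case: eqP => // -[].
rewrite -[RHS]ev; apply: (eval_stable fsub) => //.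
- by apply: leq_trans (column_lt fpos _) _; lia.
- exact: ltnW.
- move=> i ic; rewrite ev => e; have := @diagram_code_strict i c; lia.
Qed.

Lemma eval_positive x : x < n -> 0 < f x -> eval f x n = f x.
Proof.
move=> ltxn fx; rewrite -[RHS](eval_self fsub ltxn).
apply: (eval_stable fsub) => // i ix; rewrite (eval_self fsub) // => e.
by have := @diagram_code_strict x i; lia.
Qed.

Lemma eval_last0 x : x < n -> f x = 0 -> (x.+1 < n -> 0 < f x.+1) ->
  eval f x n = 0.
Proof.
move=> ltxn fx next; rewrite -[RHS]fx -[RHS](eval_self fsub ltxn).
apply: (eval_stable fsub) => // i ix; rewrite (eval_self fsub) // fx => e.
by have := @fmono x.+1 i; lia.
Qed.

(** The point [x] visits every cell of column [x] and never decreases, whence the maximality. Let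
    [B] be its final value. The point [column f B] reaches [B] and stays there: a later [i] with
    [f i = B] would also end at [B], hence equal [x], although [f x = 0]. Injectivity then gives
    [column f B = x]. *)
Lemma eval_bottom x : x.+1 < n -> f x.+1 = 0 ->
  [/\ 0 < eval f x n < n, column f (eval f x n) = x &
      forall c, 0 < c < n -> column f c = x -> c <= eval f x n].
Proof.
move=> ltxn fx; have ltn' : eval f x n < n by apply: (eval_lt fsub); lia.
have maxB c : 0 < c < n -> column f c = x -> c <= eval f x n.
  move=> /andP[c0 cn] e; rewrite -[leqLHS](eval_column c0 cn) e.
  by apply: (eval_mono fsub) => //; rewrite -e leqW // column_lt.
have Bpos : 0 < eval f x n.
  by apply: leq_trans (maxB x.+1 _ _); rewrite ?column0 //; lia.
split=> //; first by lia.
apply: (@eval_inj f n); rewrite -[RHS](eval_column Bpos ltn').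
apply: (eval_stable fsub); rewrite ?leqW ?column_lt //.
move=> i iB; rewrite eval_column // => e.
have ein : eval f i n = eval f x n by rewrite eval_positive ?e //; lia.
by have e2 := @eval_inj f n _ _ ein; rewrite e2 in e; have := @fmono x x.+1; lia.
Qed.

(* Two column bottoms in increasing order lie in the same row, and so do the
   bottoms of the columns in between, which are all the values in between. *)
Lemma diagram_code_avoids : ~ has132 (eval f ^~ n) n.
Proof.
case=> a [b [c [ltab ltbc ltcn /andP[sac scb]]]].
have ltbn := ltn_trans ltbc ltcn.
(* The permutation increases from [b] on if [f b > 0], and the last zero of [f] is sent to 0; so [b]
   comes before that zero. *)
have [fb fb1 ltb1] : [/\ f b = 0, f b.+1 = 0 & b.+1 < n].
  have [fb|fb] := posnP (f b); last first.
    have fc : 0 < f c := leq_trans fb (fmono (ltnW ltbc) ltcn).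
    have := diagram_code_strict ltbc ltcn fc.
    by move: scb; rewrite !eval_positive //; lia.
  have [fb1|fb1] := posnP (f b.+1); first by split=> //; lia.
  by move: scb; rewrite (@eval_last0 b).
have fa1 : f a.+1 = 0 by have := @fmono a.+1 b; lia.
have lta1 : a.+1 < n by lia.
have [] := eval_bottom lta1 fa1; have [] := eval_bottom ltb1 fb1.
set A := eval f a n in sac *; set B := eval f b n in scb *.
set v := eval f c n in sac scb *.
move=> /andP[B0 Bn] colB maxB /andP[A0 An] colA maxA.
have row t : t <= b -> t < B /\ column f (B - t) = b - t.
  by rewrite -colB => letb; apply: column_sub.
have [l1 e1] := row (b - a) (leq_subr _ _).
have leA : B - (b - a) <= A by apply: maxA; rewrite ?e1; lia.
have eA : A = B - (b - a).
  have [|_ e2] := row (B - A); first by lia.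
  by move: e2; rewrite (_ : B - (B - A) = A) ?colA; lia.
have [|_ ev] := row (B - v); first by lia.
have {}ev : column f v = b - (B - v) by rewrite -ev; congr column; lia.
have [fc|fc] := posnP (f c); last first.
  (* The cell [c] is just below [v], hence in the same column; moving left from [c] to column [a]
     gives a cell larger than the bottom [A]. *)
  have vE : v = f c by exact: eval_positive.
  have ec := column_above (leq_ltn_trans (leq0n _) ltbc) ltcn fc.
  have cv := flt (leq_ltn_trans (leq0n _) ltbc) ltcn.
  have ltcB : column f c = b - (B - v) by rewrite ec -vE.
  have [|||l2 e2] := @column_sub c (b - (B - v) - a); try lia.
  by have := maxA (c - (b - (B - v) - a)); lia.
have [fc1|fc1] := posnP (f c.+1); last first.
  by move: sac; rewrite /v (@eval_last0 c).
have [ltc1|gec1] := ltnP c.+1 n; last first.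
  by move: sac; rewrite /v (@eval_last0 c) //; lia.
(* Here [v] would be the bottom of column [c], but its column is at most [b]. *)
by have [_] := eval_bottom ltc1 fc1; rewrite -/v; lia.
Qed.

End DiagramCode.

(** * Avoiding codes without a final fixed point are diagram codes *)

Section Avoiding.

Variables (f : nat -> nat) (n : nat).
Hypotheses (fsub : subexc f n) (fmono : nondecr f n).
Hypothesis favoid : ~ has132 (eval f ^~ n) n.
Hypotheses (n1 : 1 < n) (flast : f n.-1 < n.-1).

(* A repeated value [k > 0] leaves [k] after a larger value, both after [0]. *)
Lemma avoiding_strict i : i.+1 < n -> 0 < f i.+1 -> f i < f i.+1.
Proof.
move=> lti1 fpos; rewrite ltn_neqAle fmono // andbT; apply/eqP => e.
have [||z [_ ltzn fz ez]] := @last_occurrence f n fsub 0 => //; first by lia.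
have f0 : f 0 = 0 by have := @fsub 0; lia.
have [//||j [leij ltjn fj ej]] := @last_occurrence f n fsub i.+1 => //.
apply: favoid; exists z, i, j; split=> //.
  by rewrite ltnNge; apply/negP => lezi; have := fmono lezi ltzn; lia.
rewrite ez ej f0 fpos /=.
apply: (@leq_trans (eval f i i.+2)); last exact: (eval_mono fsub).
rewrite (evalS fsub) // (eval_self fsub) ?e ?eqxx; last by lia.
by have := @fsub i; lia.
Qed.

(** A fixed point [i > 0] of [f] propagates: strict growth together with [f j <= j] fixes every
    later position, against [flast]. *)
Lemma avoiding_lt i : 0 < i < n -> f i < i.
Proof.
move=> /andP[i0 ltin]; rewrite ltn_neqAle fsub // andbT; apply/eqP => e.
have {ltin} : i <= n.-1 by lia.
suff h j : i <= j -> j < n -> f j = j by move=> /h; lia.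
elim: j => [|j IH]; first by lia.
rewrite leq_eqVlt => /predU1P[<- //|leij] ltjn.
have ej : f j = j by apply: IH; lia.
by have := @avoiding_strict j ltjn; have := fsub ltjn; have := fmono (leqnSn j) ltjn; lia.
Qed.

(* If [i.+1] is below a cell [k] that neither follows [f i] nor starts a row, then
   the column of [k.-1] just before that of [k] has bottom [k.-1], the column of
   [k] has a bottom larger than [k], and [k] itself comes later. *)
Lemma avoiding_diagram_code : diagram_code f n.
Proof.
(* Induction on prefixes makes the facts about columns available for the cells already placed. *)
suff h j : j <= n -> diagram_code f j by exact: h.
have f0 : f 0 = 0 by have := @fsub 0; lia.
elim: j => [|j IH] ltjn; first by split=> // -[].
have {IH} fcode := IH (ltnW ltjn).
have flt i : 0 < i < n -> f i < i by exact: avoiding_lt.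
split=> [//|i ij|i]; first by apply: flt; lia.
rewrite ltnS leq_eqVlt => /predU1P[ei|]; last by case: fcode => _ _; apply.
have lti1 : i.+1 < n by lia.
have [fi1|fpos] := posnP (f i.+1); first by left; have := fmono (leqnSn i) lti1; lia.
right; have ltf := avoiding_strict lti1 fpos; split=> //.
have [->|nk] := eqVneq (f i.+1) (f i).+1; first by left.
right; apply/eqP; rewrite -leqn0 leqNgt; apply/negP => cpos.
set k := f i.+1 in fpos ltf nk cpos.
have lek : k < i.+1 by apply: flt; lia.
have ltkj : k < j by lia.
have cS := column_pred fcode fpos ltkj cpos.
have k1 : 0 < k.-1 by lia.
have lck := column_lt fcode fpos ltkj.
have ltk1j : k.-1 < j by lia.
have ltk1 := column_lt fcode k1 ltk1j.
(* With [prev] this shows that [k.-1] is not a value of [f] and that [k] is one only at [i.+1]. So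
   the point at [k.-1] stays there, while the one at [k] is raised to [i.+1]. *)
have next p : i.+1 < p < n -> k < f p.
  move=> /andP[lp ltpn]; have lt2 := leq_ltn_trans lp ltpn.
  apply: leq_trans (fmono lp ltpn); apply: avoiding_strict => //.
  by apply: leq_trans fpos (fmono _ _).
have prev p : p <= i -> f p < k.-1 by move=> lp; have := fmono lp (ltnW lti1); lia.
have ex : eval f (column f k.-1) n = k.-1.
  rewrite -[RHS](eval_column fcode k1 ltk1j).
  apply: (eval_stable fsub); try lia; move=> p pn; rewrite (eval_column fcode) //.
  have [/prev|ltip] := leqP p i; first by lia.
  by have /andP[_ /(fmono ltip)] := pn; rewrite -/k; lia.
have ey : i < eval f (column f k) n.
  have ey1 : eval f (column f k) i.+1 = k.
    rewrite -[RHS](eval_column fcode fpos ltkj).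
    apply: (eval_stable fsub); try lia; move=> p pn; rewrite (eval_column fcode) //.
    by have := @prev p; lia.
  apply: (@leq_trans (eval f (column f k) i.+2)); last by apply: (eval_mono fsub); lia.
  by rewrite (evalS fsub) ?ey1 ?eqxx //; lia.
have ez : eval f i.+1 n = k.
  rewrite -[RHS](eval_self fsub lti1); apply: (eval_stable fsub) => // p pn.
  by rewrite (eval_self fsub) // -/k; have := @next p; lia.
by apply: favoid; exists (column f k.-1), (column f k), i.+1; rewrite ex ez; split; lia.
Qed.

End Avoiding.

(** * Partitions and diagram codes *)

(* The row above the first row of [l] has [w] cells, starting from [p]. *)
Fixpoint rows_above (p w : nat) (l : seq nat) : seq nat :=
  if l is x :: l' then iota p x ++ rows_above (p + w) x l' else [::].

(** Position 0 is not a cell but also has value 0, so a first row of [w] cells accounts for [w.+1]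
    zeros. *)
Definition partition_code (l : seq nat) : seq nat :=
  if l is w :: l' then nseq w.+1 0 ++ rows_above 1 w l' else [:: 0].

Lemma size_rows_above p w l : size (rows_above p w l) = sumn l.
Proof. by elim: l p w => //= x l IH p w; rewrite size_cat size_iota IH. Qed.

Lemma size_partition_code l : size (partition_code l) = (sumn l).+1.
Proof. by case: l => //= w l; rewrite size_cat size_nseq size_rows_above. Qed.

(** If the first parts are [x < y], then at index [x] one sequence still has [p + x], while the
    other has ended or starts a new row with [p + w], which is larger because [y <= w]. *)
Lemma rows_above_inj p w l l' :
  path geq w l -> path geq w l' -> 0 \notin l -> 0 \notin l' ->
  rows_above p w l = rows_above p w l' -> l = l'.
Proof.
have neq q v x y s s' : x < y -> y <= v -> 0 \notin s ->
    rows_above q v (x :: s) <> rows_above q v (y :: s').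
  move=> ltxy leyv s0 e; have := congr1 size e.
  rewrite !size_rows_above /=; case: s s0 e => [|z s] /=; first by lia.
  rewrite inE => /norP[z0 _] /(congr1 (nth 0 ^~ x)).
  rewrite !nth_cat !size_iota ltnn ltxy subnn (nth_iota _ _ ltxy).
  by case: z z0 => //= z _; lia.
elim: l p w l' => [|x l IH] p w [|y l'] //=.
- by rewrite inE => _ _ _ /norP[y0 _] /(congr1 size); rewrite size_cat size_iota /=; lia.
- by rewrite inE => _ _ /norP[x0 _] _ /(congr1 size); rewrite size_cat size_iota /=; lia.
move=> /andP[xw pl] /andP[yw pl']; rewrite !inE => /norP[x0 l0] /norP[y0 l0'] e.
have [ltxy|ltyx|exy] := ltngtP x y.
- by case: (neq p w x y l l' ltxy yw l0).
- by case: (neq p w y x l' l ltyx xw l0').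
move: e pl'; rewrite -exy => /eqP; rewrite eqseq_cat // eqxx /= => /eqP e pl'.
by rewrite (IH _ _ _ pl pl' l0 l0' e).
Qed.

Lemma rows_above_gt0 p w l : 0 < p -> 0 \notin rows_above p w l.
Proof.
elim: l p w => //= x l IH p w p0; rewrite mem_cat negb_or mem_iota IH //; lia.
Qed.

Lemma partition_code_inj m l l' : 0 < m -> is_partition m l -> is_partition m l' ->
  partition_code l = partition_code l' -> l = l'.
Proof.
move=> m0; case: l => [|w l] /and3P[]; first by move=> _ _ /eqP /=; lia.
move=> /= pl; rewrite inE => /norP[_ l0] _.
case: l' => [|w' l'] /and3P[]; first by move=> _ _ /eqP /=; lia.
move=> /= pl'; rewrite inE => /norP[_ l0'] _ [] e.
have zeros v s : count_mem 0 (nseq v 0 ++ rows_above 1 v s) = v.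
  by rewrite count_cat count_nseq (count_memPn (rows_above_gt0 _ _ _)) //= mul1n addn0.
have ew : w = w' by rewrite -(zeros w l) e zeros.
move: e pl'; rewrite -ew => /eqP; rewrite eqseq_cat // eqxx /= => /eqP e pl'.
by rewrite (rows_above_inj pl pl' l0 l0' e).
Qed.

Lemma diagram_code_extend f n : 0 < n -> diagram_code f n -> f n.-1 < f n < n ->
  f n = (f n.-1).+1 \/ column f (f n) = 0 -> diagram_code f n.+1.
Proof.
move=> n0 [f0 flt fS] /andP[fn fnn] next; split=> [//|i|i]; rewrite ltnS.
  by case/andP=> i0; rewrite leq_eqVlt => /predU1P[->//|lin]; apply: flt; rewrite i0.
rewrite leq_eqVlt => /predU1P[e|]; last exact: fS.
by rewrite -e /= in fn next; rewrite e in fn next *; right.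
Qed.

(** Rows are added one by one: [p] is the first cell of the last row built and [w] its length. The
    new row inherits the columns of the cells above it, and the bound on [f (p + w).-1] gives the
    strict increase at its first cell. *)
Lemma diagram_code_rows f p w l :
  0 < p -> path geq w l -> 0 \notin l -> 0 < w ->
  diagram_code f (p + w) -> f (p + w).-1 < p ->
  (forall t, t < w -> column f (p + t) = t) ->
  [seq f i | i <- iota (p + w) (sumn l)] = rows_above p w l ->
  diagram_code f (p + w + sumn l).
Proof.
elim: l p w => [|x l IH] p w p0 /=; first by rewrite addn0.
move=> /andP[lexw pl]; rewrite inE => /norP[x0 l0] w0 fcode flast col.
rewrite iotaD map_cat => /eqP; rewrite eqseq_cat ?size_map ?size_iota //.
case/andP=> /eqP e1 /eqP e2.
have row t : t < x -> f (p + w + t) = p + t.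
  move=> ltx; have := congr1 (nth 0 ^~ t) e1.
  by rewrite (nth_map 0) ?size_iota // !nth_iota.
have {}fcode t : t <= x -> diagram_code f (p + w + t).
  elim: t => [|t IHt] ltx; first by rewrite addn0.
  rewrite addnS; apply: diagram_code_extend; rewrite ?row //; first by lia.
  - by apply: IHt; lia.
  - case: t ltx {IHt} => [|t] ltx; first by rewrite !addn0; lia.
    by rewrite addnS /= row; lia.
  case: t ltx {IHt} => [|t] ltx; first by right; rewrite addn0 -[RHS](col 0) ?addn0.
  by left; rewrite (addnS (p + w)) /= row; lia.
rewrite addnA; apply: IH => //; try lia; first exact: fcode.
  have := row x.-1; rewrite (_ : p + w + x.-1 = (p + w + x).-1); last by lia.
  by move=> ->; lia.
move=> t ltx; rewrite (column_above (fcode x (leqnn x))) ?row //; try lia.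
by apply: col; lia.
Qed.

Lemma partition_code_diagram m l : 0 < m -> is_partition m l ->
  diagram_code (nth 0 (partition_code l)) m.+1.
Proof.
move=> m0; case: l => [|w l] /and3P[]; first by move=> _ _ /eqP /=; lia.
move=> pl; rewrite inE => /norP[w0 l0] /eqP <-.
set f := nth 0 _; rewrite -[_.+1]/(1 + w + sumn l).
have f0 i : i <= w -> f i = 0.
  by move=> lei; rewrite /f nth_cat size_nseq ltnS lei nth_nseq if_same.
apply: diagram_code_rows => //; first by lia.
- split=> [|i iw|i iw]; rewrite ?f0 //; try lia.
- by rewrite f0 //; lia.
- by move=> t lt; rewrite /column /= f0.
apply: (@eq_from_nth _ 0); rewrite size_map size_iota ?size_rows_above // => i ltil.
rewrite (nth_map 0) ?size_iota // nth_iota // /f nth_cat size_nseq.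
by rewrite ifF ?add1n; [congr nth; lia | lia].
Qed.

(** Induction on the number of unread cells. The row above starts at [p] and has [w] cells, and the
    current row has [x] cells so far; the next cell either continues the current row or starts a row
    below it. *)
Lemma diagram_code_rows_above f n p w x : diagram_code f n ->
  p + w + x <= n -> 0 < x <= w -> 0 < p ->
  (forall t, t < w -> column f (p + t) = t) ->
  (forall t, t < x -> f (p + w + t) = p + t) ->
  exists l, [/\ path geq w l, 0 \notin l &
    [seq f i | i <- iota (p + w) (n - (p + w))] = rows_above p w l].
Proof.
move=> fcode; have [k] := ubnP (n - (p + w + x)).
elim: k p w x => // k IH p w x ltk len /andP[x0 lexw] p0 col row.
have rowE : [seq f i | i <- iota (p + w) x] = iota p x.
  apply: (@eq_from_nth _ 0); rewrite size_map ?size_iota // => i ltix.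
  by rewrite (nth_map 0) ?size_iota // !nth_iota // row.
have colx t : t < x -> column f (p + w + t) = t.
  by move=> ltx; rewrite (column_above fcode) ?row //; [apply: col; lia | lia..].
have [ltn|gen] := ltnP (p + w + x) n; last first.
  exists [:: x]; rewrite /= inE lexw cats0 eq_sym -lt0n x0; split=> //.
  by rewrite -rowE; congr map; congr iota; lia.
have prev : f (p + w + x).-1 = p + x.-1.
  by rewrite -(row x.-1); [congr f; lia | lia].
have [/andP[ltxw /eqP fx]|new] := boolP ((x < w) && (f (p + w + x) == p + x)).
  apply: (IH p w x.+1) => //; try lia.
  move=> t; rewrite ltnS leq_eqVlt => /predU1P[-> //|]; exact: row.
(* The value exceeds [p + x.-1]. If it is [p + x], then [x = w] since the row does not continue;
   otherwise it is a cell of column 0, and [p + w] is the only such cell in range. *)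
have fx : f (p + w + x) = p + w.
  have ltf : f (p + w + x) < p + w + x by case: fcode => _ h _; apply: h; lia.
  case: fcode => _ _ /(_ (p + w + x).-1); rewrite prednK; last by lia.
  case/(_ ltn) => [[]|]; rewrite prev; first by lia.
  case=> fgt [fx|fx]; first by move: new; rewrite fx; lia.
  have [ltpw|gepw] := ltnP (f (p + w + x)) (p + w).
    have := col (f (p + w + x) - p); rewrite subnKC; last by lia.
    by rewrite fx; move: new; lia.
  have := colx (f (p + w + x) - (p + w)); rewrite subnKC // fx; lia.
have [||||||l [pl l0 el]] := IH (p + w) x 1 => //; try lia.
  by move=> [] // _; rewrite !addn0.
exists (x :: l); rewrite /= lexw inE negb_or l0 andbT eq_sym -lt0n; split=> //.
rewrite -el -rowE -map_cat -iotaD; congr map; congr iota; lia.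
Qed.

Lemma diagram_code_partition f m : 0 < m -> diagram_code f m.+1 ->
  exists2 l, is_partition m l & mkseq f m.+1 = partition_code l.
Proof.
move=> m0 fcode; have fmono := diagram_code_nondecr fcode.
have f1 : f 1 = 0 by case: fcode => _ /(_ 1) h _; lia.
have [//|w [w0 ltwm]] := last_occurrence (diagram_code_subexc fcode) (i := 1) fmono.
rewrite f1 => fw ew.
(* If [f w.+1] were 0, the point [w] would end at a column bottom, which is positive, and not at
   0. *)
have next : w < m -> 0 < f w.+1.
  rewrite lt0n => ltw; apply/eqP => e; have [] := eval_bottom fcode _ e => //.
  by rewrite ew.
have zeros i : i <= w -> f i = 0 by move=> /fmono/(_ ltwm); lia.
suff [l [pl l0 el]] : exists l, [/\ path geq w l, 0 \notin l &
    [seq f i | i <- iota (1 + w) (m.+1 - (1 + w))] = rows_above 1 w l].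
  have em : mkseq f m.+1 = partition_code (w :: l).
    rewrite /partition_code /mkseq -(subnKC ltwm) iotaD map_cat el.
    congr cat; apply: (@eq_from_nth _ 0); rewrite size_map size_iota ?size_nseq // => i.
    by move=> ltiw; rewrite (nth_map 0) ?size_iota // nth_iota // nth_nseq ltiw zeros.
  exists (w :: l) => //; apply/and3P; split=> //; first by rewrite inE negb_or l0; lia.
  by have := congr1 size em; rewrite size_mkseq size_partition_code => -[->].
have [ltwm'|gewm] := ltnP w m; last first.
  by exists [::]; split=> //; rewrite (_ : _ - _ = 0) //; lia.
apply: (@diagram_code_rows_above f m.+1 1 w 1) => //; try lia.
  by move=> t ltw; rewrite column0 ?zeros //; lia.
move=> [] // _; rewrite !addn0 add1n.
(* The second row starts under cell 1, the only cell of the first row in column 0. *)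
have fw1 := next ltwm'; have [_ flt /(_ w)] := fcode.
case=> // [[]|]; first by lia.
rewrite fw => -[_ [//|]]; have ltf : f w.+1 < w.+1 by apply: flt; lia.
by rewrite column0; [lia | apply: zeros].
Qed.

(** * From permutations and finite functions to codes over [nat] *)

Definition natfun m (f : {ffun 'I_m.+1 -> 'I_m.+1}) (i : nat) : nat := f (inord i).

Lemma transpose_tperm n (i j x : 'I_n) : tperm i j x = transpose i j x :> nat.
Proof.
rewrite /transpose !val_eqE.
by case: tpermP => [->|->|/eqP/negPf-> /eqP/negPf->]; rewrite ?eqxx //; case: eqP => [->|].
Qed.

Lemma phi_eval m (f : {ffun 'I_m.+1 -> 'I_m.+1}) x :
  phi f x = eval (natfun f) x m.+1 :> nat.
Proof.
rewrite /phi.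
have -> : (\prod_(i < m.+1) tperm i (f i) =
           \prod_(0 <= i < m.+1) tperm (inord i : 'I_m.+1) (f (inord i)))%g.
  by rewrite big_mkord; apply: eq_bigr => i _; rewrite inord_val.
suff h k : k <= m.+1 -> (\prod_(0 <= i < k)
    tperm (inord i : 'I_m.+1) (f (inord i)))%g x = eval (natfun f) x k :> nat by exact: h.
elim: k => [|k IH] ltkm; first by rewrite big_nil perm1.
by rewrite big_nat_recr //= permM transpose_tperm IH ?inordK // ltnW.
Qed.

Lemma pattern132E (l : 'I_3) : pattern132 l = transpose 1 2 l :> nat.
Proof. by rewrite transpose_tperm !inordK. Qed.

Lemma contains132P m (s : 'S_m.+1) (t : nat -> nat) :
  (forall x : 'I_m.+1, s x = t x :> nat) ->
  reflect (has132 t m.+1) (contains pattern132 s).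
Proof.
move=> st; apply: (iffP existsP) => [[g /andP[/'forall_forallP lt /'forall_forallP pat]]|].
  pose o k := g (inord k).
  have lto k l : k < l < 3 -> o k < o l.
    by move=> ?; apply: (implyP (lt _ _)); rewrite !inordK; lia.
  have pato k l : k < 3 -> l < 3 -> (t (o k) < t (o l)) = (transpose 1 2 k < transpose 1 2 l).
    by move=> ? ?; rewrite -!st (eqP (pat _ _)) !pattern132E !inordK.
  by exists (o 0), (o 1), (o 2); rewrite !lto ?ltn_ord // !pato.
move=> [i [j [k [ij jk kn /andP[ik kj]]]]].
pose q := nth 0 [:: i; j; k].
have qn (l : 'I_3) : q l < m.+1 by case: l => -[|[|[|//]]] ? /=; rewrite /q /=; lia.
exists [ffun l : 'I_3 => inord (q l) : 'I_m.+1].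
apply/andP; split; apply/'forall_forallP => l l'; rewrite !ffunE ?st !inordK ?qn //;
  [apply/implyP | rewrite !pattern132E];
  case: l l' => [[|[|[|//]]] ?] [[|[|[|//]]] ?]; rewrite /q /= ?/transpose /=; lia.
Qed.

(** The image of the last point is the last entry of the code; cancelling the last transposition
    leaves shorter codes. *)
Lemma eval_inj_code f g n : subexc f n -> subexc g n ->
  (forall x, x < n -> eval f x n = eval g x n) -> forall i, i < n -> f i = g i.
Proof.
elim: n => // n IH fsub gsub e.
have en : f n = g n by rewrite -(eval_self fsub) // -(eval_self gsub) // e.
move=> i; rewrite ltnS leq_eqVlt => /predU1P[-> //|ltin]; apply: IH ltin.
- by move=> j ltj; apply/fsub/leqW.
- by move=> j ltj; apply/gsub/leqW.
move=> x ltxn; have := e x (leqW ltxn); rewrite /= en; exact: transpose_inj.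
Qed.

Lemma subexceedantP m (f : {ffun 'I_m.+1 -> 'I_m.+1}) :
  reflect (subexc (natfun f) m.+1) (subexceedant f).
Proof.
apply: (iffP forallP) => h i; last by have := h i (ltn_ord i); rewrite /natfun inord_val.
by move=> ltim; have := h (inord i); rewrite inordK.
Qed.

Lemma phi_inj m :
  {in [pred f : {ffun 'I_m.+1 -> 'I_m.+1} | subexceedant f] &, injective (@phi m.+1)}.
Proof.
move=> f g /subexceedantP fsub /subexceedantP gsub e.
apply/ffunP => i; apply: val_inj; rewrite -(inord_val i).
apply: (eval_inj_code fsub gsub) (ltn_ord i) => x ltx.
by rewrite -(inordK ltx) -!phi_eval e.
Qed.

Definition avoiding_codes m : {set {ffun 'I_m.+1 -> 'I_m.+1}} :=
  [set f in F_incr m.+1 | ~~ contains pattern132 (phi f)].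

Lemma card_avoiding_codes m : a m.+1 = #|avoiding_codes m|.
Proof.
have -> : a m.+1 = #|[set phi f | f in avoiding_codes m]|.
  apply: eq_card => s; rewrite !inE; apply/andP/imsetP => [[/imsetP[f fF ->] av]|].
    by exists f => //; rewrite inE fF.
  by move=> [f]; rewrite inE => /andP[fF av] ->; split=> //; apply: imset_f.
rewrite card_in_imset // => f g; rewrite !inE.
by move=> /andP[/andP[fs _] _] /andP[/andP[gs _] _]; apply: phi_inj.
Qed.

Lemma nondecreasingP m (f : {ffun 'I_m.+1 -> 'I_m.+1}) :
  reflect (nondecr (natfun f) m.+1) (nondecreasing f).
Proof.
apply: (iffP 'forall_forallP) => h i j.
  move=> leij ltjm; have := h (inord i) (inord j).
  by rewrite !inordK ?leij //; apply: leq_ltn_trans ltjm.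
by apply/implyP => /h/(_ (ltn_ord j)); rewrite /natfun !inord_val.
Qed.

Lemma avoiding_codesP m (f : {ffun 'I_m.+1 -> 'I_m.+1}) :
  reflect [/\ subexc (natfun f) m.+1, nondecr (natfun f) m.+1 &
              ~ has132 (eval (natfun f) ^~ m.+1) m.+1]
          (f \in avoiding_codes m).
Proof.
have avP := contains132P (t := eval (natfun f) ^~ m.+1) (phi_eval f).
rewrite !inE -andbA; apply: (iffP and3P).
  by move=> [/subexceedantP ? /nondecreasingP ? /avP].
by move=> [? ? ?]; split; [exact/subexceedantP | exact/nondecreasingP | exact/avP].
Qed.

Lemma eq_has132 s t n : (forall i, i < n -> s i = t i) -> has132 s n -> has132 t n.
Proof.
move=> st [i [j [k [ij jk kn h]]]]; exists i, j, k; split=> //.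
by rewrite -!st //; lia.
Qed.

(** The new point comes last, so it could only play the 2 of a 132, but its value is the maximum. *)
Lemma has132_fixed_last f n : subexc f n.+1 -> f n = n ->
  has132 (eval f ^~ n.+1) n.+1 <-> has132 (eval f ^~ n) n.
Proof.
move=> fsub fn.
have e i : i < n -> eval f i n.+1 = eval f i n.
  by move=> ltin; rewrite (evalS fsub) // fn; case: eqP.
split=> [[i [j [k [ij jk kn /andP[ik kj]]]]]|[i [j [k [ij jk kn h]]]]].
  have [ekn|nkn] := eqVneq k n.
    have := @eval_lt f n.+1 fsub j n.+1; rewrite ekn (eval_self fsub) // fn in kj.
    by lia.
  by exists i, j, k; rewrite -!e; try lia; split; lia.
by exists i, j, k; rewrite !e; try lia; split; lia.
Qed.

(** * Codes with a final fixed point *)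

Definition last_fixed m : {set {ffun 'I_m.+1 -> 'I_m.+1}} :=
  [set f : {ffun 'I_m.+1 -> 'I_m.+1} | f ord_max == ord_max].

Definition fix_last m (f : {ffun 'I_m.+1 -> 'I_m.+1}) : {ffun 'I_m.+2 -> 'I_m.+2} :=
  [ffun i : 'I_m.+2 => if i < m.+1 then inord (natfun f i) else i].

Lemma fix_lastE m (f : {ffun 'I_m.+1 -> 'I_m.+1}) i : i < m.+1 ->
  natfun (fix_last f) i = natfun f i.
Proof.
move=> ltim; rewrite /natfun ffunE inordK; last by lia.
by rewrite ltim inordK // ltnW // ltnS ltn_ord.
Qed.

Lemma fix_last_max m (f : {ffun 'I_m.+1 -> 'I_m.+1}) : fix_last f ord_max = ord_max.
Proof. by rewrite ffunE ltnn. Qed.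

Lemma natfun_max m (f : {ffun 'I_m.+1 -> 'I_m.+1}) : natfun f m = f ord_max.
Proof. by rewrite /natfun; congr (val (f _)); apply: val_inj; rewrite /= inordK. Qed.

Lemma fix_last_inj m : injective (@fix_last m).
Proof.
move=> f g e; apply/ffunP => i; apply: val_inj.
have := congr1 (fun h => natfun h i) e.
by rewrite !fix_lastE // /natfun inord_val.
Qed.

Lemma avoiding_codes_fix_last m (f : {ffun 'I_m.+1 -> 'I_m.+1}) :
  (fix_last f \in avoiding_codes m.+1) = (f \in avoiding_codes m).
Proof.
set g := fix_last f; have gm : natfun g m.+1 = m.+1 by rewrite natfun_max fix_last_max.
have gE i : i < m.+1 -> natfun g i = natfun f i by exact: fix_lastE.
have subE : subexc (natfun g) m.+2 <-> subexc (natfun f) m.+1.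
  split=> h i ltim; first by rewrite -gE //; apply: h; lia.
  have [e|lt] := eqVneq i m.+1; first by rewrite e gm.
  by rewrite gE; [apply: h|]; lia.
have avE : subexc (natfun g) m.+2 ->
    has132 (eval (natfun g) ^~ m.+2) m.+2 <-> has132 (eval (natfun f) ^~ m.+1) m.+1.
  move=> h; apply: iff_trans (has132_fixed_last h gm) _.
  by split; apply: eq_has132 => i _; apply: eq_eval => j /gE.
apply/avoiding_codesP/avoiding_codesP => -[fsub fmono av].
  split; [exact/subE | | by move/(avE fsub)].
  by move=> i j leij ltjm; rewrite -!gE ?fmono //; lia.
have gsub := (subE.2 fsub); split=> //; last by move/(avE gsub).
move=> i j leij ltjm; have [ej|nej] := eqVneq j m.+1.
  by rewrite ej gm; apply: leq_trans (gsub _ _) _; lia.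
by rewrite !gE ?fmono //; lia.
Qed.

Lemma card_avoiding_codes_fixed m :
  #|avoiding_codes m.+1 :&: last_fixed m.+1| = #|avoiding_codes m|.
Proof.
rewrite -(card_imset _ (@fix_last_inj m)); apply: eq_card => f.
rewrite in_setI [f \in last_fixed _]inE; apply/andP/imsetP => [[fA /eqP fm]|[g gA ->]]; last first.
  by rewrite avoiding_codes_fix_last fix_last_max.
have /avoiding_codesP[fsub _ _] := fA.
suff e : f = fix_last [ffun i : 'I_m.+1 => inord (natfun f i)].
  by eexists; last exact: e; rewrite -avoiding_codes_fix_last -e.
apply/ffunP => i; apply: val_inj; rewrite ffunE; case: ifPn => [ltim|geim].
  have lt := leq_ltn_trans (fsub i (ltn_ord i)) ltim.
  by rewrite /= /natfun ffunE !inordK // inord_val.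
have -> : i = ord_max by apply: val_inj => /=; have := ltn_ord i; lia.
by rewrite fm.
Qed.

(** * Codes without a final fixed point, and the recurrence *)

Definition code_of_partition m (s : {bseq m.+1 of 'I_m.+2}) :
    {ffun 'I_m.+2 -> 'I_m.+2} :=
  [ffun i : 'I_m.+2 => inord (nth 0 (partition_code (map val s)) i)].

(** Diagram codes are subexceedant, so [inord] never falls back to its default value. *)
Lemma code_of_partitionE m (s : {bseq m.+1 of 'I_m.+2}) i :
  is_partition m.+1 (map val s) -> i < m.+2 ->
  natfun (code_of_partition s) i = nth 0 (partition_code (map val s)) i.
Proof.
move=> sP ltim; rewrite /natfun ffunE inordK inordK //.
apply: leq_ltn_trans (ltim).
exact: (diagram_code_subexc (partition_code_diagram (ltn0Sn m) sP)).
Qed.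

Lemma eq_column f g n c : subexc f n -> (forall i, i < n -> f i = g i) -> c < n ->
  column f c = column g c.
Proof.
move=> fsub fg; rewrite /column; suff h k d : d < n -> column_top f k d = column_top g k d.
  by move=> /h->.
elim: k d => //= k IH d ltdn; rewrite -fg // IH //.
exact: leq_ltn_trans (fsub d ltdn) ltdn.
Qed.

Lemma eq_diagram_code f g n : 0 < n -> (forall i, i < n -> f i = g i) ->
  diagram_code f n -> diagram_code g n.
Proof.
move=> n0 fg fcode; have fsub := diagram_code_subexc fcode.
have [f0 flt fS] := fcode; split; first by rewrite -fg.
  by move=> i lti; rewrite -fg; [apply: flt | lia].
move=> i ltin; rewrite -!fg ?(ltnW ltin) // -(eq_column fsub fg); first exact: fS.
exact: leq_ltn_trans (fsub _ ltin) ltin.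
Qed.

Lemma card_avoiding_codes_moved m :
  #|avoiding_codes m.+1 :\: last_fixed m.+1| = npartitions m.+1.
Proof.
rewrite /npartitions -(@card_in_imset _ _ (@code_of_partition m)); last first.
  move=> s t; rewrite !inE => sP tP e; apply: val_inj; apply: (inj_map val_inj).
  apply: (partition_code_inj (ltn0Sn m) sP tP).
  have sz u : is_partition m.+1 u -> size (partition_code u) = m.+2.
    by move=> /and3P[_ _ /eqP]; rewrite size_partition_code => ->.
  apply: (@eq_from_nth _ 0); rewrite ?sz // => i ltim.
  by rewrite -!code_of_partitionE // e.
apply: eq_card => f; rewrite in_setD [f \in last_fixed _]inE; apply/andP/imsetP.
  case=> fm /avoiding_codesP[fsub fmono av].
  have flast : natfun f m.+1 < m.+1.
    rewrite natfun_max ltn_neqAle -ltnS ltn_ord andbT.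
    by apply: contraNneq fm => e; apply/eqP/val_inj.
  have fcode := avoiding_diagram_code fsub fmono av isT flast.
  have [l lP e] := diagram_code_partition (ltn0Sn m) fcode.
  have [s sl] := is_partition_bseq lP; exists s; first by rewrite inE sl.
  apply/ffunP => i; apply: val_inj; have := ltn_ord i => ltim.
  have sP : is_partition m.+1 (map val s) by rewrite sl.
  rewrite -[i in LHS]inord_val -[i in RHS]inord_val -[LHS]/(natfun f i).
  by rewrite -[RHS]/(natfun _ i) code_of_partitionE // sl -e nth_mkseq.
case=> s; rewrite inE => sP ->.
have fcode := eq_diagram_code (ltn0Sn _) (fun i lt => esym (code_of_partitionE sP lt))
  (partition_code_diagram (ltn0Sn m) sP).
split; last first.
  apply/avoiding_codesP; split.
  - exact: diagram_code_subexc fcode.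
  - exact: diagram_code_nondecr fcode.
  - exact: diagram_code_avoids fcode.
apply/eqP => e; have [_ /(_ m.+1) h _] := fcode.
by move: h; rewrite natfun_max e /= ltnSn ltnn => /(_ isT).
Qed.

Theorem theorem5p1 :
  a 1 = 1 /\ forall n : nat, 2 <= n -> a n = a n.-1 + npartitions n.-1.
Proof.
split.
  rewrite card_avoiding_codes.
  have -> : avoiding_codes 0 = setT.
    apply/setP => f; rewrite in_setT; apply/avoiding_codesP.
    have f0 i : natfun f i = 0 by rewrite /natfun (ord1 (f _)).
    split=> [i _ | i j _ _ | [i [j [k [ij jk kn _]]]]]; rewrite ?f0 //; lia.
  by rewrite cardsT card_ffun card_ord.
case=> [|[|m]] // _.
rewrite !card_avoiding_codes -(cardsID (last_fixed m.+1)).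
by rewrite card_avoiding_codes_fixed card_avoiding_codes_moved.
Qed.
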